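(* Let $L$ be an $r\times s$ $\boldsymbol\rho$-latin rectangle with $r,s\le n$ and $n>\min\{r,s\}$. For $t\in\{r,s\}$ put $P_t=\{\ell\in[k] : \rho_\ell-e_\ell>n-t\}$ (so $P_{\min\{r,s\}}\subseteq P_{\max\{r,s\}}$), and write $\bar P_t=[k]\setminus P_t$. Call a sequence $\{(a_\ell,b_\ell)\}_{\ell=1}^k$ fitting if $a_\ell,b_\ell$ are nonnegative integers for all $\ell\in[k]$ and $$\sum_{\ell\in[k]}a_\ell=r(n-s)+|P_r|(n-r)-\sum_{\ell\in P_r}(\rho_\ell-e_\ell),$$ $$\sum_{\ell\in[k]}b_\ell=s(n-r)+|P_s|(n-s)-\sum_{\ell\in P_s}(\rho_\ell-e_\ell),$$ and for every $\ell\in[k]$: $$a_\ell+b_\ell\le\begin{cases}2n-r-s+e_\ell-\rho_\ell & \text{if } \ell\in P_{\min\{r,s\}},\\ n-\max\{r,s\} & \text{if } \ell\in P_{\max\{r,s\}}\setminus P_{\min\{r,s\}},\\ \rho_\ell-e_\ell & \text{if } \ell\in \bar P_{\max\{r,s\}}.\end{cases}$$ Then $L$ can be completed to an $n\times n$ $\boldsymbol\rho$-latin square if and only if there exists a fitting sequence $\{(a_\ell,b_\ell)\}_{\ell=1}^k$ for which one (equivalently, every) condition in the list (R1)–(R6) holds, and also one (equivalently, every) condition in the list (C1)–(C6) holds. For a fixed fitting sequence, the six conditions (R1)–(R6) are mutually equivalent, and the six conditions (C1)–(C6) are mutually equivalent. (R1) For all $I\subseteq[r]$: $$|I|(n-s)\le\sum_{\ell\in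 P_r}\min\{a_\ell+\rho_\ell-e_\ell-n+r,\ \mu_I(\ell)\}+\sum_{\ell\in\bar P_r}\min\{a_\ell,\ \mu_I(\ell)\}.$$ (R2) For all $K\subseteq[k]$: $$\sum_{\ell\in K\cap P_r}(\rho_\ell-e_\ell)\le\sum_{i\in[r]}\min\{n-s,\ \mu_K(i)\}-\sum_{\ell\in K}a_\ell+|K\cap P_r|(n-r).$$ (R3) For all $I\subseteq[r]$: $$|I|(n-s)\ge\sum_{\ell\in P_r}\big((a_\ell+\rho_\ell+\mu_I(\ell))\dot- n\big)+\sum_{\ell\in\bar P_r}\big(a_\ell\dot-\mu_{\bar I}(\ell)\big).$$ (R4) For all $K\subseteq[k]$: $$\sum_{\ell\in K\cap P_r}(\rho_\ell-e_\ell)\ge\sum_{i\in[r]}\big((n-s)\dot-\mu_{\bar K}(i)\big)+|K\cap P_r|(n-r)-\sum_{\ell\in K}a_\ell.$$ (R5) For all $I\subseteq[r]$ and $K\subseteq[k]$: $$|I|(n-s)\le\sum_{\ell\in K\cap P_r}(\rho_\ell-e_\ell)+\sum_{\ell\in K}a_\ell+\mu_I(\bar K)-|K\cap P_r|(n-r).$$ (R6) For all $I\subseteq[r]$ and $K\subseteq[k]$: $$\sum_{\ell\in K\cap P_r}(\rho_\ell-e_\ell)\le|I|(n-s)+|K\cap P_r|(n-r)+\mu_K(\bar I)-\sum_{\ell\in K}a_\ell.$$ (C1)–(C6) are obtained from (R1)–(R6), respectively, by interchanging $r$ and $s$, replacing $I\subseteq[r]$ by $J\subseteq[s]$ (with $\bar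 J=[s]\setminus J$ and column quantities $\mu_J(\ell)$, $\mu_K(j)$, $\mu_{\bar K}(j)$, $\mu_J(\bar K)$, $\mu_K(\bar J)$), replacing $P_r$ by $P_s$, and replacing $a_\ell$ by $b_\ell$. For example: (C1) For all $J\subseteq[s]$: $$|J|(n-r)\le\sum_{\ell\in P_s}\min\{b_\ell+\rho_\ell-e_\ell-n+s,\ \mu_J(\ell)\}+\sum_{\ell\in\bar P_s}\min\{b_\ell,\ \mu_J(\ell)\}.$$ (C3) For all $J\subseteq[s]$: $$|J|(n-r)\ge\sum_{\ell\in P_s}\big((b_\ell+\rho_\ell+\mu_J(\ell))\dot- n\big)+\sum_{\ell\in\bar P_s}\big(b_\ell\dot-\mu_{\bar J}(\ell)\big).$$
   Context: Let $n,k$ be positive integers. Let $\boldsymbol\rho=(\rho_1,\dots,\rho_k)$ be integers with $1\le\rho_\ell\le n\le k$ for all $\ell\in[k]=\{1,\dots,k\}$ and $\sum_{\ell\in[k]}\rho_\ell=n^2$. The symbols are the elements of $[k]$. A $\boldsymbol\rho$-latin square of order $n$ is an $n\times n$ array in which every cell contains a symbol of $[k]$, each symbol occurs at most once in each row and at most once in each column, and each symbol $\ell$ occurs exactly $\rho_\ell$ times. An $r\times s$ $\boldsymbol\rho$-latin rectangle is an $r\times s$ array in which every cell contains a symbol of $[k]$, each symbol occurs at most once in each row and at most once in each column, and each symbol $\ell$ occurs at most $\rho_\ell$ times. It can be completed to an $n\times n$ $\boldsymbol\rho$-latin square if there is a $\boldsymbol\rho$-latin square of order $n$ whose top-left $r\times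 s$ subarray equals it. For a rectangle $L$, its rows are $[r]$, its columns are $[s]$, and $e_\ell$ is the number of occurrences of symbol $\ell$ in $L$. For $i\in[r]$, $j\in[s]$, $\ell\in[k]$, $I\subseteq[r]$, $J\subseteq[s]$, $K\subseteq[k]$: - $\mu_K(i)$ is the number of symbols of $K$ not occurring in row $i$ of $L$; - $\mu_K(j)$ is the number of symbols of $K$ not occurring in column $j$ of $L$; - $\mu_I(\ell)$ is the number of rows in $I$ not containing $\ell$; - $\mu_J(\ell)$ is the number of columns in $J$ not containing $\ell$; - $\mu_K(I)=\sum_{i\in I}\mu_K(i)$, $\mu_I(K)=\sum_{\ell\in K}\mu_I(\ell)$, $\mu_K(J)=\sum_{j\in J}\mu_K(j)$, $\mu_J(K)=\sum_{\ell\in K}\mu_J(\ell)$. Complements are taken within the natural ground set: $\bar I=[r]\setminus I$, $\bar J=[s]\setminus J$, $\bar K=[k]\setminus K$. For reals $x,y$, $x\dot- y:=\max\{0,x-y\}$, and $x-y\dot- z$ means $(x-y)\dot- z$. *)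

(* Defs.v *)
(* Symbols [k] are represented by 'I_k (symbol l+1 <-> ordinal l),
   rows [r] by 'I_r, columns [s] by 'I_s. All arithmetic of the inequalities is in int. *)
From mathcomp Require Import all_boot all_order all_algebra.
Set Implicit Arguments. Unset Strict Implicit. Unset Printing Implicit Defensive.
Import Order.TTheory GRing.Theory Num.Theory.

Definition ecount (k r s : nat) (L : 'I_r -> 'I_s -> 'I_k) (l : 'I_k) : nat :=
  #|[set p : 'I_r * 'I_s | L p.1 p.2 == l]|.

Definition rows_inj (k r s : nat) (L : 'I_r -> 'I_s -> 'I_k) : Prop :=
  forall (i : 'I_r) (j1 j2 : 'I_s), L i j1 = L i j2 -> j1 = j2.

Definition cols_inj (k r s : nat) (L : 'I_r -> 'I_s -> 'I_k) : Prop :=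
  forall (i1 i2 : 'I_r) (j : 'I_s), L i1 j = L i2 j -> i1 = i2.

Definition is_rho_rect (k r s : nat) (rho : 'I_k -> nat) (L : 'I_r -> 'I_s -> 'I_k) : Prop :=
  [/\ rows_inj L, cols_inj L & forall l, ecount L l <= rho l].

Definition is_rho_square (n k : nat) (rho : 'I_k -> nat) (S : 'I_n -> 'I_n -> 'I_k) : Prop :=
  [/\ rows_inj S, cols_inj S & forall l, ecount S l = rho l].

Definition completable (n k r s : nat) (rho : 'I_k -> nat) (L : 'I_r -> 'I_s -> 'I_k) : Prop :=
  exists S : 'I_n -> 'I_n -> 'I_k, is_rho_square rho S /\
    forall (i j : 'I_n) (hi : (i < r)%N) (hj : (j < s)%N), S i j = L (Ordinal hi) (Ordinal hj).

Definition transp (k r s : nat) (L : 'I_r -> 'I_s -> 'I_k) : 'I_s -> 'I_r -> 'I_k :=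
  fun j i => L i j.

Definition row_has (k r s : nat) (L : 'I_r -> 'I_s -> 'I_k) (i : 'I_r) (l : 'I_k) : bool :=
  [exists j, L i j == l].

Definition mu_sym (k r s : nat) (L : 'I_r -> 'I_s -> 'I_k) (K : {set 'I_k}) (i : 'I_r) : nat :=
  #|[set l in K | ~~ row_has L i l]|.

Definition mu_row (k r s : nat) (L : 'I_r -> 'I_s -> 'I_k) (I : {set 'I_r}) (l : 'I_k) : nat :=
  #|[set i in I | ~~ row_has L i l]|.

Definition mu_sym_set (k r s : nat) (L : 'I_r -> 'I_s -> 'I_k) (K : {set 'I_k}) (I : {set 'I_r}) : nat :=
  \sum_(i in I) mu_sym L K i.

Definition mu_row_set (k r s : nat) (L : 'I_r -> 'I_s -> 'I_k) (I : {set 'I_r}) (K : {set 'I_k}) : nat :=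
  \sum_(l in K) mu_row L I l.

Local Open Scope ring_scope.

Definition dsub (x y : int) : int := Num.max 0 (x - y).

Definition Pset (n k r s : nat) (rho : 'I_k -> nat) (L : 'I_r -> 'I_s -> 'I_k) (t : nat) : {set 'I_k} :=
  [set l | (n%:Z - t%:Z) < ((rho l)%:Z - (ecount L l)%:Z)].

Definition def (k r s : nat) (rho : 'I_k -> nat) (L : 'I_r -> 'I_s -> 'I_k) (l : 'I_k) : int :=
  (rho l)%:Z - (ecount L l)%:Z.

Definition fitting_bound (n k r s : nat) (rho : 'I_k -> nat) (L : 'I_r -> 'I_s -> 'I_k) (l : 'I_k) : int :=
  if l \in Pset n rho L (minn r s) then 2 * n%:Z - r%:Z - s%:Z + (ecount L l)%:Z - (rho l)%:Z
  else if l \in Pset n rho L (maxn r s) then n%:Z - (maxn r s)%:Z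
  else def rho L l.

Definition fitting (n k r s : nat) (rho : 'I_k -> nat) (L : 'I_r -> 'I_s -> 'I_k)
    (a b : 'I_k -> nat) : Prop :=
  [/\ (\sum_l a l)%:Z = r%:Z * (n%:Z - s%:Z) + (#|Pset n rho L r|)%:Z * (n%:Z - r%:Z)
                         - \sum_(l in Pset n rho L r) def rho L l,
      (\sum_l b l)%:Z = s%:Z * (n%:Z - r%:Z) + (#|Pset n rho L s|)%:Z * (n%:Z - s%:Z)
                         - \sum_(l in Pset n rho L s) def rho L l
    & forall l, (a l)%:Z + (b l)%:Z <= fitting_bound n rho L l].

Definition R1 (n k r s : nat) (rho : 'I_k -> nat) (L : 'I_r -> 'I_s -> 'I_k) (a : 'I_k -> nat) : Prop :=
  forall I : {set 'I_r},
    (#|I|)%:Z * (n%:Z - s%:Z) <=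
      \sum_(l in Pset n rho L r)
          Num.min ((a l)%:Z + (rho l)%:Z - (ecount L l)%:Z - n%:Z + r%:Z) (mu_row L I l)%:Z
    + \sum_(l in ~: Pset n rho L r) Num.min (a l)%:Z (mu_row L I l)%:Z.

Definition R2 (n k r s : nat) (rho : 'I_k -> nat) (L : 'I_r -> 'I_s -> 'I_k) (a : 'I_k -> nat) : Prop :=
  forall K : {set 'I_k},
    \sum_(l in K :&: Pset n rho L r) def rho L l <=
      \sum_(i : 'I_r) Num.min (n%:Z - s%:Z) (mu_sym L K i)%:Z
      - \sum_(l in K) (a l)%:Z + (#|K :&: Pset n rho L r|)%:Z * (n%:Z - r%:Z).

Definition R3 (n k r s : nat) (rho : 'I_k -> nat) (L : 'I_r -> 'I_s -> 'I_k) (a : 'I_k -> nat) : Prop :=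
  forall I : {set 'I_r},
    (#|I|)%:Z * (n%:Z - s%:Z) >=
      \sum_(l in Pset n rho L r) dsub ((a l)%:Z + (rho l)%:Z + (mu_row L I l)%:Z) n%:Z
    + \sum_(l in ~: Pset n rho L r) dsub (a l)%:Z (mu_row L (~: I) l)%:Z.

Definition R4 (n k r s : nat) (rho : 'I_k -> nat) (L : 'I_r -> 'I_s -> 'I_k) (a : 'I_k -> nat) : Prop :=
  forall K : {set 'I_k},
    \sum_(l in K :&: Pset n rho L r) def rho L l >=
      \sum_(i : 'I_r) dsub (n%:Z - s%:Z) (mu_sym L (~: K) i)%:Z
      + (#|K :&: Pset n rho L r|)%:Z * (n%:Z - r%:Z) - \sum_(l in K) (a l)%:Z.

Definition R5 (n k r s : nat) (rho : 'I_k -> nat) (L : 'I_r -> 'I_s -> 'I_k) (a : 'I_k -> nat) : Prop :=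
  forall (I : {set 'I_r}) (K : {set 'I_k}),
    (#|I|)%:Z * (n%:Z - s%:Z) <=
      \sum_(l in K :&: Pset n rho L r) def rho L l + \sum_(l in K) (a l)%:Z
      + (mu_row_set L I (~: K))%:Z - (#|K :&: Pset n rho L r|)%:Z * (n%:Z - r%:Z).

Definition R6 (n k r s : nat) (rho : 'I_k -> nat) (L : 'I_r -> 'I_s -> 'I_k) (a : 'I_k -> nat) : Prop :=
  forall (I : {set 'I_r}) (K : {set 'I_k}),
    \sum_(l in K :&: Pset n rho L r) def rho L l <=
      (#|I|)%:Z * (n%:Z - s%:Z) + (#|K :&: Pset n rho L r|)%:Z * (n%:Z - r%:Z)
      + (mu_sym_set L K (~: I))%:Z - \sum_(l in K) (a l)%:Z.

Definition C1 n k r s rho L b := @R1 n k s r rho (@transp k r s L) b.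
Definition C2 n k r s rho L b := @R2 n k s r rho (@transp k r s L) b.
Definition C3 n k r s rho L b := @R3 n k s r rho (@transp k r s L) b.
Definition C4 n k r s rho L b := @R4 n k s r rho (@transp k r s L) b.
Definition C5 n k r s rho L b := @R5 n k s r rho (@transp k r s L) b.
Definition C6 n k r s rho L b := @R6 n k s r rho (@transp k r s L) b.

(* Main.v *)
Require Import Defs.
From mathcomp Require Import all_boot all_order all_algebra zify.
Set Implicit Arguments. Unset Strict Implicit. Unset Printing Implicit Defensive.
Import Order.TTheory GRing.Theory Num.Theory.

(* In a completion let x, y, z count the copies of l in the top-right,
   bottom-left and bottom-right blocks.  The new rows and columns force
   y + z <= n - r and x + z <= n - s, so x and y exceed the truncated
   differences (rho - e) - (n - r) and (rho - e) - (n - s) by nonnegative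
   amounts, which are a and b; fitting says exactly that z >= 0 and that the
   block sizes are right.  Each of (R1)-(R6) is then the min-cut condition for
   choosing, in every old row, n - s absent symbols so that l is chosen x
   times.  Given such choices for rows and columns, spread the z copies of each
   symbol over the new rows, and properly edge-colour the bipartite graph
   (rows, symbols) with the n - s new columns as colours; then forget the new
   rows of the corner and edge-colour (columns, symbols) with the n - r new rows
   as colours. *)

(** * Integral transportation problems and their min-cut criterion *)

Section Transport.
Local Open Scope ring_scope.
Variables A B : finType.
Implicit Types (c : A -> B -> int) (p : A -> int) (q : B -> int).
Implicit Types (I : {set A}) (J : {set B}).

(** In the network source, [A], [B], sink, this is the capacity of the cut with source side [I] and
    [J], minus the total supply. Supplies and demands are integers, so that one unit can be
    subtracted before they are known to be positive. *)
Definition cut c p q I J : int :=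
  \sum_(u : A * B) c u.1 u.2 * ((u.1 \in I) && (u.2 \notin J))%:Z
  + \sum_b q b * (b \in J)%:Z - \sum_a p a * (a \in I)%:Z.

Lemma cut_eq c c' p p' q q' : c =2 c' -> p =1 p' -> q =1 q' ->
  cut c p q =2 cut c' p' q'.
Proof.
move=> hc hp hq I J; rewrite /cut; congr (_ + _ - _); apply: eq_bigr => u _.
- by rewrite hc.
- by rewrite hq.
- by rewrite hp.
Qed.

Lemma cutB c c' p p' q q' I J :
  cut (fun a b => c a b - c' a b) (fun a => p a - p' a) (fun b => q b - q' b) I J
  = cut c p q I J - cut c' p' q' I J.
Proof.
have sumBl (T : finType) (f g h : T -> int) :
    \sum_t (f t - g t) * h t = \sum_t f t * h t - \sum_t g t * h t.
  by rewrite -sumrB; apply: eq_bigr => t _; rewrite mulrBl.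
rewrite /cut (sumBl _ (fun u => c u.1 u.2) (fun u => c' u.1 u.2)) !sumBl /=; lia.
Qed.

Lemma sum_delta (T : finType) (x : T) (F : T -> int) :
  \sum_y (y == x)%:Z * F y = F x.
Proof.
rewrite (bigD1 x) //= eqxx mul1r big1 ?addr0 // => y /negPf ->; exact: mul0r.
Qed.

Lemma cut_delta x y P Q I J :
  cut (fun a b => ((a, b) == (x, y))%:Z) (fun a => (a == x)%:Z * P)
      (fun b => (b == y)%:Z * Q) I J
  = ((x \in I) && (y \notin J))%:Z + Q * (y \in J)%:Z - P * (x \in I)%:Z.
Proof.
rewrite /cut; congr (_ + _ - _).
- rewrite -(sum_delta (x, y) (fun u => ((u.1 \in I) && (u.2 \notin J))%:Z)).
  by apply: eq_bigr => -[a b] _.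
- rewrite -(sum_delta y (fun b => Q * (b \in J)%:Z)).
  by apply: eq_bigr => b _; rewrite mulrA.
- rewrite -(sum_delta x (fun a => P * (a \in I)%:Z)).
  by apply: eq_bigr => a _; rewrite mulrA.
Qed.

(** The supply and demand terms are modular, and each crossing indicator is submodular. The edge
    from [x] to [y] crosses [(I, J)] but neither the union nor the intersection, which gains
    [c x y]. *)
Lemma cut_submod c p q I I' J J' x y : (forall a b, 0 <= c a b) ->
  x \in I -> x \notin I' -> y \notin J -> y \in J' ->
  cut c p q (I :|: I') (J :|: J') + cut c p q (I :&: I') (J :&: J') + c x y
    <= cut c p q I J + cut c p q I' J'.
Proof.
move=> c0 xI xI' yJ yJ'; rewrite -subr_ge0 /cut.
set s1 := (X in X + _ - _ + _); set s2 := \sum_b _; set s3 := \sum_a _.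
set t1 := (X in _ + (X + _ - _)); set t2 := \sum_b _; set t3 := \sum_a _.
set u1 := (X in _ - (X + _ - _ + _ + _)); set u2 := \sum_b _; set u3 := \sum_a _.
set v1 := (X in _ - (_ + (X + _ - _) + _)); set v2 := \sum_b _; set v3 := \sum_a _.
have e2 : s2 + t2 = u2 + v2.
  rewrite -!big_split /=; apply: eq_bigr => b _; rewrite !inE -!mulrDr.
  by case: (b \in J); case: (b \in J').
have e3 : s3 + t3 = u3 + v3.
  rewrite -!big_split /=; apply: eq_bigr => b _; rewrite !inE -!mulrDr.
  by case: (b \in I); case: (b \in I').
have e1 : u1 + v1 + c x y <= s1 + t1.
  rewrite -!big_split /= (bigD1 (x, y)) //= [leRHS](bigD1 (x, y)) //=.
  rewrite !inE xI (negPf xI') (negPf yJ) yJ' /= !mulr0 !mulr1 !addr0 ?add0r.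
  rewrite [leLHS]addrC; apply: lerD => //.
  apply: ler_sum => -[a b] _ /=; rewrite !inE -!mulrDr; apply: ler_wpM2l => //.
  by case: (a \in I); case: (a \in I'); case: (b \in J); case: (b \in J').
lia.
Qed.

(* Induction on the total capacity: one unit of capacity at [(x, y)] can be
   either discarded or used, for otherwise there are two tight cuts, one
   separating [x] from [y] and one separating [y] from [x], and this
   contradicts submodularity. *)
Lemma transport_cut (c : A -> B -> nat) p q :
  \sum_a p a = \sum_b q b ->
  (forall I J, 0 <= cut (fun a b => (c a b)%:Z) p q I J) ->
  exists f : A -> B -> nat, [/\ forall a b, (f a b <= c a b)%N,
    forall a, \sum_b (f a b)%:Z = p a & forall b, \sum_a (f a b)%:Z = q b].
Proof.
have [m] := ubnP (\sum_(u : A * B) c u.1 u.2)%N.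
elim: m c p q => // m IHm c p q.
(* Without capacity, singleton cuts give [p a <= 0] and [0 <= q b]; the totals agree, so everything
   vanishes and the zero flow works. *)
have [/forallP c0|] := boolP [forall u : A * B, c u.1 u.2 == 0%N].
  move=> _ epq hcut; exists (fun _ _ => 0%N).
  have cE a b : c a b = 0%N by exact/eqP/(c0 (a, b)).
  have p0 a : 0 <= - p a.
    have := hcut [set a] set0; rewrite /cut big1 => [|u _]; last by rewrite cE mul0r.
    rewrite big1 => [|b _]; last by rewrite inE mulr0.
    rewrite !add0r (bigD1 a) //= inE eqxx mulr1 big1 ?addr0 // => b /negPf hb.
    by rewrite inE hb mulr0.
  have q0 b : 0 <= q b.
    have := hcut set0 [set b]; rewrite /cut big1 => [|u _]; last by rewrite cE mul0r.
    rewrite (bigD1 b) //= inE eqxx mulr1 big1 ?addr0 => [|d /negPf hd]; last first.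
      by rewrite inE hd mulr0.
    by rewrite big1 => [|a _]; [rewrite add0r subr0 | rewrite inE mulr0].
  have sq : \sum_b q b = 0.
    apply/eqP; rewrite eq_le (sumr_ge0 _ (fun b _ => q0 b)) andbT -epq -oppr_ge0 -sumrN.
    exact: sumr_ge0.
  have sp : \sum_a - p a = 0 by rewrite sumrN epq sq.
  split=> // [a|b]; rewrite big1 //; apply/esym/eqP.
  - move/eqP: sp; rewrite psumr_eq0 // => /allP /(_ a (mem_index_enum _)) /=.
    by rewrite oppr_eq0.
  - by move/eqP: sq; rewrite psumr_eq0 // => /allP /(_ b (mem_index_enum _)).
rewrite negb_forall => /existsP [[x y] /= cxy] hm epq hcut.
pose c' a b := (c a b - ((a, b) == (x, y)))%N.
have c'E a b : (c' a b)%:Z = (c a b)%:Z - ((a, b) == (x, y))%:Z.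
  rewrite /c'; case: eqP => [[-> ->]|_] /=; last by rewrite subn0 subr0.
  by rewrite -subzn // lt0n.
have hm' : (\sum_(u : A * B) c' u.1 u.2 < m)%N.
  rewrite -ltnS; apply: leq_trans hm; rewrite ltnS (bigD1 (x, y)) //=.
  rewrite [X in (_ < X)%N](bigD1 (x, y)) //= -addSn leq_add //.
    by rewrite /c' eqxx /= subn1 prednK // lt0n.
  by apply: leq_sum => -[a b] _; rewrite leq_subr.
pose p' a := p a - (a == x)%:Z * 1; pose q' b := q b - (b == y)%:Z * 1.
have drop I J : cut (fun a b => (c' a b)%:Z) p q I J
    = cut (fun a b => (c a b)%:Z) p q I J - ((x \in I) && (y \notin J))%:Z.
  have := cut_delta x y 0 0 I J; rewrite !mul0r addr0 subr0 => <-.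
  rewrite -cutB; apply: cut_eq => // a; by rewrite mulr0 subr0.
have use I J : cut (fun a b => (c' a b)%:Z) p' q' I J
    = cut (fun a b => (c a b)%:Z) p q I J
      - (((x \in I) && (y \notin J))%:Z + (y \in J)%:Z - (x \in I)%:Z).
  by have := cut_delta x y 1 1 I J; rewrite !mul1r => <-; rewrite -cutB; apply: cut_eq.
have [/forallP hd|] := boolP [forall u : {set A} * {set B},
    0 <= cut (fun a b => (c' a b)%:Z) p q u.1 u.2].
  have [f [fc fp fq]] := IHm c' p q hm' epq (fun I J => hd (I, J)).
  by exists f; split=> // a b; apply: leq_trans (fc a b) _; rewrite leq_subr.
rewrite negb_forall => /existsP [[I J] /=]; rewrite drop -ltNge => hI.
have [/forallP hd|] := boolP [forall u : {set A} * {set B},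
    0 <= cut (fun a b => (c' a b)%:Z) p' q' u.1 u.2].
  have epq' : \sum_a p' a = \sum_b q' b.
    by rewrite !sumrB !sum_delta epq.
  have [f [fc fp fq]] := IHm c' p' q' hm' epq' (fun I J => hd (I, J)).
  exists (fun a b => f a b + ((a, b) == (x, y)))%N; split=> [a b|a|b].
  - have := fc a b; rewrite /c'; case: eqP => [[-> ->]|_] /=; last by rewrite subn0 addn0.
    by move: cxy; lia.
  - under eq_bigr => b _ do rewrite PoszD.
    rewrite big_split /= fp /p'; suff -> : \sum_b ((a, b) == (x, y))%:Z = (a == x)%:Z * 1.
      by rewrite subrK.
    rewrite -(sum_delta y (fun=> (a == x)%:Z * 1)); apply: eq_bigr => b _.
    by rewrite xpair_eqE; case: (a == x); case: (b == y).
  - under eq_bigr => a _ do rewrite PoszD.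
    rewrite big_split /= fq /q'; suff -> : \sum_a ((a, b) == (x, y))%:Z = (b == y)%:Z * 1.
      by rewrite subrK.
    rewrite -(sum_delta x (fun=> (b == y)%:Z * 1)); apply: eq_bigr => a _.
    by rewrite xpair_eqE; case: (a == x); case: (b == y).
rewrite negb_forall => /existsP [[I' J'] /=]; rewrite use -ltNge => hI'.
have g1 := hcut I J; have g2 := hcut I' J'.
(* By integrality, a cut that turns negative when it drops by at most one was tight and did drop.
   Discarding lowers only cuts with [x] inside and [y] outside; using lowers only cuts with [y]
   inside and [x] outside. *)
have [/andP [xI yJ] e1] : (x \in I) && (y \notin J) /\ cut (fun a b => (c a b)%:Z) p q I J = 0.
  by move: hI; case: (_ && _) => /=; lia.
have [[xI' yJ'] e2] : (x \notin I' /\ y \in J') /\ cut (fun a b => (c a b)%:Z) p q I' J' = 0.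
  by move: hI'; case: (x \in I'); case: (y \in J') => /=; lia.
have := cut_submod p q (fun a b => isT : 0 <= (c a b)%:Z) xI xI' yJ yJ'.
have := hcut (I :|: I') (J :|: J'); have := hcut (I :&: I') (J :&: J').
by rewrite e1 e2; move: cxy; lia.
Qed.

End Transport.

Lemma Posz_sum (T : finType) (F : T -> nat) :
  ((\sum_t F t)%N%:Z = \sum_t (F t)%:Z)%R.
Proof. exact: (big_morph Posz PoszD (erefl _)). Qed.

(** The fractional flow [h / d] certifies every cut: [d] times the cut is a sum over pairs whose
    terms are [d * c a b - h a b], [h a b] or zero. *)
Lemma transport_frac (A B : finType) (d : nat) (c h : A -> B -> nat)
    (p : A -> nat) (q : B -> nat) : 0 < d ->
  (forall a b, h a b <= d * c a b) ->
  (forall a, \sum_b h a b = d * p a) -> (forall b, \sum_a h a b = d * q b) ->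
  exists f : A -> B -> nat, [/\ forall a b, f a b <= c a b,
    forall a, \sum_b f a b = p a & forall b, \sum_a f a b = q b].
Proof.
move=> d0 hc hp hq.
have epq : (\sum_a (p a)%:Z = \sum_b (q b)%:Z)%R.
  rewrite -!Posz_sum; congr Posz; apply/eqP; rewrite -(eqn_pmul2l d0) !big_distrr /=.
  apply/eqP; under eq_bigr => a _ do rewrite -hp.
  by rewrite exchange_big; apply: eq_bigr.
have [I J|f [fc fp fq]] := transport_cut (c := c) epq.
  have hpZ a : (d%:Z * (p a)%:Z = \sum_b (h a b)%:Z)%R by rewrite -Posz_sum hp.
  have hqZ b : (d%:Z * (q b)%:Z = \sum_a (h a b)%:Z)%R by rewrite -Posz_sum hq.
  rewrite -(pmulr_rge0 (x := d%:Z)%R) // /cut !(mulrBr, mulrDr) !mulr_sumr.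
  under [X in (_ + X - _)%R]eq_bigr => b _ do rewrite mulrA hqZ mulr_suml.
  under [X in (_ - X)%R]eq_bigr => a _ do rewrite mulrA hpZ mulr_suml.
  rewrite [X in (_ + X - _)%R]exchange_big !pair_bigA -big_split -sumrB /=.
  apply: sumr_ge0 => -[a b] _ /=; have := hc a b.
  by case: (a \in I); case: (b \in J) => /=; lia.
exists f; split=> // [a|b]; apply/eqP; rewrite -eqz_nat Posz_sum.
- by rewrite fp.
- by rewrite fq.
Qed.

(** * Bipartite edge colouring with one regular side *)

Lemma sum_cst (T : finType) (m : nat) : \sum_(t : T) m = #|T| * m.
Proof. by rewrite -sum_nat_const; apply: eq_bigl. Qed.

Lemma sum_sumType (A B : finType) (F : A + B -> nat) :
  \sum_x F x = \sum_a F (inl a) + \sum_b F (inr b).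
Proof. by rewrite big_sumType. Qed.

(* A row-perfect matching that also covers every [b] of maximal degree is a
   0-1 flow; [E / d.+1], completed by one extra source feeding the
   vertices [b] of smaller degree, is a fractional such flow. *)
Lemma edge_coloring (A B : finType) (d : nat) (E : A -> B -> bool) :
  (forall a, \sum_b E a b = d) -> (forall b, \sum_a E a b <= d) ->
  exists g : A -> 'I_d -> B, [/\ forall a c, E a (g a c),
    forall a, injective (g a) & forall c, injective (g^~ c)].
Proof.
elim: d E => [|d IHd] E hA hB.
  have no (c : 'I_0) : False by case: c.
  by exists (fun _ c => False_rect B (no c)); split=> [? []|? []|[]].
pose deg b := \sum_a E a b.
(* [inr tt] is the extra source. Its edge to [b] is closed exactly when [b] has degree [d.+1], so
   such a [b] must be matched. In [h] it raises every degree to [d.+1], and a demand of one at each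
   [b] leaves it a supply of [#|B| - #|A|]. *)
pose c (x : A + unit) b : nat := if x is inl a then E a b : nat else (deg b < d.+1 : nat).
pose h (x : A + unit) b : nat := if x is inl a then E a b : nat else d.+1 - deg b.
have degE : \sum_b deg b = d.+1 * #|A|.
  by rewrite exchange_big /=; under eq_bigr => a _ do rewrite hA; rewrite sum_cst mulnC.
pose p (x : A + unit) : nat := if x is inl a then 1 else #|B| - #|A|.
have [//| | | |f [fc fp fq]] := @transport_frac _ _ d.+1 c h p (fun=> 1).
- case=> [a|[]] b /=; first by case: (E a b).
  by have := hB b; rewrite -/(deg b); case: ltnP => /=; lia.
- case=> [a|[]] /=; first by rewrite hA muln1.
  rewrite sumnB => [|b _]; last exact: hB.
  by rewrite sum_cst degE mulnBr mulnC.
- move=> b; rewrite sum_sumType /= -/(deg b) muln1.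
  have -> : \sum_(u : unit) (d.+1 - deg b) = d.+1 - deg b.
    by rewrite sum_cst card_unit mul1n.
  exact: subnKC (hB b).
have fqE b : \sum_a f (inl a) b + f (inr tt) b = 1.
  rewrite -(fq b) sum_sumType; congr (_ + _).
  by rewrite (bigD1 tt) //= big1 ?addn0 // => -[].
have m_ex a : exists b, 0 < f (inl a) b.
  have := fp (inl a); case: (boolP [exists b, 0 < f (inl a) b]) => [/existsP //|].
  rewrite negb_exists => /forallP h0; rewrite big1 // => b _.
  by have := h0 b; lia.
have [m hm] := fin_all_exists m_ex.
pose E' a b := E a b && (f (inl a) b == 0).
have EE' a b : E a b = E' a b + f (inl a) b :> nat.
  by have := fc (inl a) b; rewrite /E' /=; case: (E a b); case: (f _ _) => [|[]].
have [a|b|g [gE gA gB]] := IHd E'.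
- have := hA a; rewrite (eq_bigr _ (fun b _ => EE' a b)) big_split /= fp /=; lia.
- have := hB b; rewrite (eq_bigr _ (fun a _ => EE' a b)) big_split /=.
  have := fqE b; have := fc (inr tt) b; rewrite /= /deg.
  rewrite (eq_bigr _ (fun a _ => EE' a b)) big_split /=.
  by set s := \sum_a f _ _; case: ltnP => /=; lia.
(* Colour [ord0] is the matching [m]; the other colours are those of the remaining graph [E']. *)
exists (fun a c => if unlift ord0 c is Some c' then g a c' else m a); split.
- move=> a x; case: (unliftP ord0 x) => [y|] _; first by have /andP [] := gE a y.
  by have := fc (inl a) (m a); have := hm a; rewrite /=; case: (E a _); lia.
- move=> a x y; case: (unliftP ord0 x) => [x' ->|->]; case: (unliftP ord0 y) => [y' ->|->] //.
  + by move/gA => ->.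
  + by move=> e; have /andP [_ /eqP] := gE a x'; rewrite e; have := hm a; lia.
  + by move=> e; have /andP [_ /eqP] := gE a y'; rewrite -e; have := hm a; lia.
- move=> x a a'; case: (unliftP ord0 x) => [x' _|_]; first exact: gB.
  move=> e; apply/eqP/negPn/negP => ne; have := fqE (m a).
  rewrite (bigD1 a) //= (bigD1 a') 1?eq_sym //=.
  have := hm a; have := hm a'; rewrite -e.
  by case: (f (inl a) _) => [|u]; case: (f (inl a') _) => [|v]; rewrite // !addSn addnS.
Qed.

(** * Indicator sums, and extrema over subsets *)

Lemma card_set_sum (T : finType) (P : pred T) : #|[set t | P t]| = \sum_t P t.
Proof.
by rewrite -sum1_card big_mkcond /=; apply: eq_bigr => t _; rewrite inE; case: (P t).
Qed.

Lemma sum_eq1 (T : finType) (x : T) : \sum_y (x == y) = 1.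
Proof. by rewrite (bigD1 x) //= eqxx big1 // => y; rewrite eq_sym => /negPf ->. Qed.

Lemma sum_inj_le1 (A B : finType) (f : A -> B) y :
  injective f -> \sum_x (f x == y) = [exists x, f x == y].
Proof.
move=> fI; case: existsP => [[x /eqP <-]|no] /=.
  by under eq_bigr => z _ do rewrite (inj_eq fI) eq_sym; rewrite sum_eq1.
by apply: big1 => x _; apply/eqP; rewrite eqb0; apply/negP => h; apply: no; exists x.
Qed.

Section SubsetSums.
Local Open Scope ring_scope.
Variable T : finType.
Implicit Types (u v : T -> int) (K : {set T}).

Lemma sum_setC K u : \sum_(t in K) u t + \sum_(t in ~: K) u t = \sum_t u t.
Proof.
rewrite [RHS](bigID (mem K)) /=; congr (_ + _).
by apply: eq_bigl => t; rewrite inE.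
Qed.

Lemma sum_split K u v :
  \sum_(t in K) u t + \sum_(t in ~: K) v t = \sum_t (if t \in K then u t else v t).
Proof.
rewrite -(sum_setC K); congr (_ + _); apply: eq_bigr => t; first by move=> ->.
by rewrite inE => /negPf ->.
Qed.

(** The right side is smallest at the [K] that picks the smaller of [u t] and [v t] for each [t].
    This trades the minima in the conditions for quantification over subsets. *)
Lemma le_sum_min u v (c : int) :
  c <= \sum_t Num.min (u t) (v t)
  <-> forall K, c <= \sum_(t in K) u t + \sum_(t in ~: K) v t.
Proof.
split=> [h K|/(_ [set t | u t <= v t])]; rewrite sum_split.
- by apply: le_trans h _; apply: ler_sum => t _; case: ifP => _; lia.
- move=> h; apply: le_trans h _; apply: ler_sum => t _; rewrite inE; case: ifP; lia.
Qed.

Lemma sum_max_le u (c : int) :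
  \sum_t Num.max 0 (u t) <= c <-> forall K, \sum_(t in K) u t <= c.
Proof.
have [h1 h2] := le_sum_min (fun t => - u t) (fun=> 0) (- c).
have e1 : \sum_t Num.min (- u t) 0 = - \sum_t Num.max 0 (u t).
  by rewrite -sumrN; apply: eq_bigr => t _; lia.
have e2 K : \sum_(t in K) - u t + \sum_(t in ~: K) 0 = - \sum_(t in K) u t.
  by rewrite sumrN [X in _ + X]big1 ?addr0.
rewrite e1 lerN2 in h1 h2; split=> [/h1 h K|h]; first by have := h K; rewrite e2 lerN2.
by apply: h2 => K; rewrite e2 lerN2.
Qed.

End SubsetSums.

(** * Occurrences and absences in a rectangle *)

Section Counting.
Variables (k r s : nat) (L : 'I_r -> 'I_s -> 'I_k).

Lemma ecountE l : ecount L l = \sum_i \sum_j (L i j == l).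
Proof.
by rewrite /ecount card_set_sum pair_bigA.
Qed.

Lemma sum_ecount : \sum_l ecount L l = r * s.
Proof.
under eq_bigr => l _ do rewrite ecountE.
rewrite exchange_big /= -[in RHS](card_ord r) -sum_cst; apply: eq_bigr => i _.
rewrite exchange_big /= -[in RHS](card_ord s) -[RHS]muln1 -sum_cst.
by apply: eq_bigr => j _; rewrite sum_eq1.
Qed.

Lemma ecount_transp l : ecount (transp L) l = ecount L l.
Proof.
rewrite ecountE /ecount card_set_sum -(pair_bigA _ (fun j i => (L i j == l) : nat)).
by rewrite exchange_big.
Qed.

Lemma Pset_transp n rho t : Pset n rho (transp L) t = Pset n rho L t.
Proof. by apply/setP => l; rewrite !inE ecount_transp. Qed.

Lemma mu_rowE I l : mu_row L I l = \sum_(i in I) ~~ row_has L i l.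
Proof.
rewrite /mu_row card_set_sum [RHS]big_mkcond /=.
by apply: eq_bigr => i _; case: (i \in I).
Qed.

Lemma mu_symE K i : mu_sym L K i = \sum_(l in K) ~~ row_has L i l.
Proof.
rewrite /mu_sym card_set_sum [RHS]big_mkcond /=.
by apply: eq_bigr => l _; case: (l \in K).
Qed.

Lemma mu_exchange I K : mu_sym_set L K I = mu_row_set L I K.
Proof.
rewrite /mu_sym_set /mu_row_set; under eq_bigr => i _ do rewrite mu_symE.
by rewrite exchange_big; apply: eq_bigr => l _; rewrite mu_rowE.
Qed.

Lemma ecount_row_has l : rows_inj L -> ecount L l = \sum_i row_has L i l.
Proof. by move=> Li; rewrite ecountE; apply: eq_bigr => i _; exact/sum_inj_le1/Li. Qed.

Lemma mu_row_setC I l : rows_inj L -> mu_row L I l + mu_row L (~: I) l + ecount L l = r.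
Proof.
move=> Li; rewrite ecount_row_has // !mu_rowE.
rewrite big_mkcond [X in _ + X + _]big_mkcond -!big_split /=.
rewrite -[RHS]muln1 -[X in X * _]card_ord -sum_cst.
by apply: eq_bigr => i _; rewrite inE; case: (i \in I); case: row_has.
Qed.

End Counting.

(** * Mutual equivalence of the six conditions *)

Section Equivalences.
Local Open Scope ring_scope.
Variables (n k r s : nat) (rho : 'I_k -> nat) (L : 'I_r -> 'I_s -> 'I_k) (a : 'I_k -> nat).
Hypotheses (hrho : forall l, (ecount L l <= rho l)%N) (hr : (r <= n)%N) (Li : rows_inj L).

(* The number of copies of [l] that a completion with parameters [a] places in
   the new columns of the old rows. *)
Definition outer (l : 'I_k) : nat := (a l + ((rho l - ecount L l) - (n - r)))%N.

Lemma in_Pset l : (l \in Pset n rho L r) = (n - r < rho l - ecount L l)%N.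
Proof. by rewrite inE; have := hrho l; move: hr; lia. Qed.

Lemma outerE l : (outer l)%:Z =
  (a l)%:Z + (if l \in Pset n rho L r then def rho L l - (n%:Z - r%:Z) else 0).
Proof.
rewrite in_Pset /outer /def; have := hrho l; move: hr; case: ifP; lia.
Qed.

Lemma sum_outer (K : {set 'I_k}) : \sum_(l in K) (outer l)%:Z =
  \sum_(l in K) (a l)%:Z + \sum_(l in K :&: Pset n rho L r) def rho L l
  - (#|K :&: Pset n rho L r|)%:Z * (n%:Z - r%:Z).
Proof.
under eq_bigr => l _ do rewrite outerE.
rewrite big_split -big_mkcondr /= -addrA; congr (_ + _).
under eq_bigl => l do rewrite -in_setI.
by rewrite sumrB sumr_const -mulr_natl natz.
Qed.

Lemma sum_card (T : finType) (I : {set T}) (c : int) : \sum_(t in I) c = (#|I|)%:Z * c.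
Proof. by rewrite sumr_const -mulr_natl natz. Qed.

Lemma mu_row_setZ I K : (mu_row_set L I K)%:Z = \sum_(l in K) (mu_row L I l)%:Z.
Proof. exact: (big_morph Posz PoszD (erefl _)). Qed.

Lemma mu_sym_setZ I K : (mu_sym_set L K I)%:Z = \sum_(i in I) (mu_sym L K i)%:Z.
Proof. exact: (big_morph Posz PoszD (erefl _)). Qed.

(** The min-cut condition for sending [n - s] units from each row to symbols absent from it, with
    demand [outer l] at [l]. All six conditions are compared with it. *)
Definition outer_bound := forall (I : {set 'I_r}) (K : {set 'I_k}),
  (#|I|)%:Z * (n%:Z - s%:Z) <= \sum_(l in K) (outer l)%:Z + (mu_row_set L I (~: K))%:Z.

Lemma R5P : R5 n rho L a <-> outer_bound.
Proof. by split=> h I K; have := h I K; rewrite sum_outer; lia. Qed.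

(** For fixed [I] the worst [K] is found symbol by symbol, which produces the minima; [outer] merges
    the two sums over [Pset] and its complement. *)
Lemma R1P : R1 n rho L a <-> outer_bound.
Proof.
have e I : \sum_(l in Pset n rho L r)
      Num.min ((a l)%:Z + (rho l)%:Z - (ecount L l)%:Z - n%:Z + r%:Z) (mu_row L I l)%:Z
    + \sum_(l in ~: Pset n rho L r) Num.min (a l)%:Z (mu_row L I l)%:Z
    = \sum_l Num.min (outer l)%:Z (mu_row L I l)%:Z.
  rewrite sum_split; apply: eq_bigr => l _; rewrite outerE /def; case: ifP; lia.
split=> h I; last by rewrite e; apply/le_sum_min => K; rewrite -mu_row_setZ.
by move: (h I); rewrite e => /le_sum_min h' K; rewrite mu_row_setZ.
Qed.

(** For fixed [K] the worst [I] consists of the rows with [n - s] above [mu_sym L (~: K) i], which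
    produces the truncated differences. *)
Lemma R4P : R4 n rho L a <-> outer_bound.
Proof.
have e (I : {set 'I_r}) K : \sum_(i in I) (n%:Z - s%:Z - (mu_sym L (~: K) i)%:Z)
    = (#|I|)%:Z * (n%:Z - s%:Z) - (mu_row_set L I (~: K))%:Z.
  by rewrite sumrB sum_card -mu_exchange mu_sym_setZ.
have eK K : (\sum_(l in K :&: Pset n rho L r) def rho L l >=
      \sum_(i : 'I_r) dsub (n%:Z - s%:Z) (mu_sym L (~: K) i)%:Z
      + (#|K :&: Pset n rho L r|)%:Z * (n%:Z - r%:Z) - \sum_(l in K) (a l)%:Z)
    = (\sum_(i < r) Num.max 0 (n%:Z - s%:Z - (mu_sym L (~: K) i)%:Z) <= \sum_(l in K) (outer l)%:Z).
  by rewrite sum_outer; set u := (X in _ = (X <= _)); rewrite -[X in X + _ - _]/u; lia.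
split=> h.
  by move=> I K; move: (h K); rewrite eK => /sum_max_le /(_ I); rewrite e; lia.
move=> K; rewrite eK; apply/sum_max_le => I; rewrite e; have := h I K; lia.
Qed.

Hypothesis total : \sum_l (outer l)%:Z = r%:Z * (n%:Z - s%:Z).

(** Replace both sets by their complements and subtract from [total]. *)
Lemma outer_boundC : outer_bound <-> forall (I : {set 'I_r}) (K : {set 'I_k}),
  \sum_(l in K) (outer l)%:Z <= (#|I|)%:Z * (n%:Z - s%:Z) + (mu_sym_set L K (~: I))%:Z.
Proof.
have cardC (I : {set 'I_r}) : (#|I|)%:Z * (n%:Z - s%:Z)
    = r%:Z * (n%:Z - s%:Z) - (#|~: I|)%:Z * (n%:Z - s%:Z).
  have -> : r%:Z = (#|I|)%:Z + (#|~: I|)%:Z by rewrite -PoszD cardsC card_ord.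
  by rewrite mulrDl addrK.
split=> h I K; have := h (~: I) (~: K); rewrite ?setCK mu_exchange.
- have := sum_setC K (fun l => (outer l)%:Z); rewrite total (cardC I); lia.
- have := sum_setC K (fun l => (outer l)%:Z); rewrite total (cardC I); lia.
Qed.

Lemma R6P : R6 n rho L a <-> outer_bound.
Proof.
rewrite outer_boundC; split=> h I K; have := h I K; rewrite sum_outer; lia.
Qed.

Lemma R2P : R2 n rho L a <-> outer_bound.
Proof.
rewrite outer_boundC.
have eK K : (\sum_(l in K :&: Pset n rho L r) def rho L l <=
      \sum_(i : 'I_r) Num.min (n%:Z - s%:Z) (mu_sym L K i)%:Z
      - \sum_(l in K) (a l)%:Z + (#|K :&: Pset n rho L r|)%:Z * (n%:Z - r%:Z))
  = (\sum_(l in K) (outer l)%:Z <= \sum_(i < r) Num.min (n%:Z - s%:Z) (mu_sym L K i)%:Z).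
  by rewrite sum_outer; lia.
split=> h.
  by move=> I K; move: (h K); rewrite eK => /le_sum_min /(_ I); rewrite sum_card mu_sym_setZ.
move=> K; rewrite eK; apply/le_sum_min => I; rewrite sum_card -mu_sym_setZ; exact: h.
Qed.

(** In the complemented form, fix [I] and take the worst [K] symbol by symbol. On [Pset],
    [mu_row_setC] turns [outer l] minus the absences in [~: I] into [a + rho + mu - n], with [mu]
    the absences in [I]. *)
Lemma R3P : R3 n rho L a <-> outer_bound.
Proof.
rewrite outer_boundC.
have e I : \sum_(l in Pset n rho L r) dsub ((a l)%:Z + (rho l)%:Z + (mu_row L I l)%:Z) n%:Z
    + \sum_(l in ~: Pset n rho L r) dsub (a l)%:Z (mu_row L (~: I) l)%:Z
    = \sum_l Num.max 0 ((outer l)%:Z - (mu_row L (~: I) l)%:Z).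
  rewrite sum_split; apply: eq_bigr => l _; rewrite outerE /def /dsub.
  have := mu_row_setC I l Li; case: ifP; lia.
have e2 (I : {set 'I_r}) (K : {set 'I_k}) : \sum_(l in K) ((outer l)%:Z - (mu_row L (~: I) l)%:Z)
   = \sum_(l in K) (outer l)%:Z - (mu_sym_set L K (~: I))%:Z.
  by rewrite sumrB mu_exchange mu_row_setZ.
split=> h I.
  by move: (h I); rewrite e => /sum_max_le h' K; move: (h' K); rewrite e2; lia.
by rewrite e; apply/sum_max_le => K; rewrite e2; have := h I K; lia.
Qed.

Lemma R_equiv : [<-> R1 n rho L a; R2 n rho L a; R3 n rho L a;
                     R4 n rho L a; R5 n rho L a; R6 n rho L a].
Proof.
tfae; by [move/R1P/R2P | move/R2P/R3P | move/R3P/R4P | move/R4P/R5P | move/R5P/R6P | move/R6P/R1P].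
Qed.

End Equivalences.

(** * Squares cut into old and new rows and columns *)

Section Blocks.
Variables (n t : nat) (ht : t <= n).

Definition block (i : 'I_n) : 'I_t + 'I_(n - t) :=
  split (cast_ord (esym (subnKC ht)) i).
Definition unblock (u : 'I_t + 'I_(n - t)) : 'I_n := cast_ord (subnKC ht) (unsplit u).

Lemma blockK : cancel block unblock.
Proof. by move=> i; rewrite /unblock /block splitK cast_ordKV. Qed.

Lemma unblockK : cancel unblock block.
Proof. by move=> u; rewrite /unblock /block cast_ordK unsplitK. Qed.

Lemma block_lt (i : 'I_n) (hi : i < t) : block i = inl (Ordinal hi).
Proof. by apply: (can_inj unblockK); rewrite blockK; apply: val_inj. Qed.

Lemma unblock_lt (i : 'I_t) : unblock (inl i) < t.
Proof. exact: (ltn_ord i). Qed.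

End Blocks.

Definition block_completion (k r s m p : nat) (rho : 'I_k -> nat) (L : 'I_r -> 'I_s -> 'I_k)
    (T : 'I_r + 'I_m -> 'I_s + 'I_p -> 'I_k) :=
  [/\ forall u, injective (T u), forall v, injective (T^~ v),
      forall i j, T (inl i) (inl j) = L i j
    & forall l, \sum_u \sum_v (T u v == l) = rho l].

Lemma completableP (n k r s : nat) (rho : 'I_k -> nat) (L : 'I_r -> 'I_s -> 'I_k) :
  r <= n -> s <= n -> completable n rho L <->
  exists T : 'I_r + 'I_(n - r) -> 'I_s + 'I_(n - s) -> 'I_k, block_completion rho L T.
Proof.
move=> hr hs; have [br bs] := (onW_bij predT (Bijective (unblockK hr) (blockK hr)),
                               onW_bij predT (Bijective (unblockK hs) (blockK hs))).
split=> [[S [[Sr Sc Srho] SL]]|[T [Tr Tc TL Trho]]].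
- exists (fun u v => S (unblock hr u) (unblock hs v)); split.
  + by move=> u v v' /Sr /(can_inj (unblockK hs)).
  + by move=> v u u' /Sc /(can_inj (unblockK hr)).
  + move=> i j; rewrite (SL _ _ (unblock_lt hr i) (unblock_lt hs j)).
    by congr L; apply: val_inj.
  + move=> l; rewrite -Srho ecountE [RHS](reindex _ br); apply: eq_bigr => u _.
    by rewrite [RHS](reindex _ bs).
- exists (fun i j => T (block hr i) (block hs j)); split; [split|].
  + by move=> i j j' /Tr /(can_inj (blockK hs)).
  + by move=> i i' j /Tc /(can_inj (blockK hr)).
  + move=> l; rewrite -Trho ecountE (reindex _ br); apply: eq_bigr => u _.
    by rewrite (reindex _ bs); apply: eq_bigr => v _; rewrite !unblockK.
  + by move=> i j hi hj; rewrite !block_lt TL.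
Qed.

(** * Building a completion from prescribed symbol sets *)

Lemma sum_leq_eq (T : finType) (F G : T -> nat) :
  (forall t, F t <= G t) -> \sum_t F t = \sum_t G t -> F =1 G.
Proof.
move=> h e t; have := e; rewrite (bigD1 t) //= [RHS](bigD1 t) //=.
have : \sum_(u | u != t) F u <= \sum_(u | u != t) G u by apply: leq_sum.
have := h t; set f := \sum_(_ | _) F _; set g := \sum_(_ | _) G _; lia.
Qed.

Lemma sum_inj_le (A B : finType) (f : A -> B) (P : pred B) y :
  injective f -> (forall x, P (f x)) -> \sum_x (f x == y) <= P y.
Proof.
by move=> fI fP; rewrite sum_inj_le1 //; case: existsP => // -[x /eqP <-]; rewrite fP.
Qed.

(** [FR i] and [FC j] prescribe the symbols that old row [i] and old column [j] receive in the new
    cells, and [z] the corner counts. Two edge colourings turn these sets into positions. *)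
Lemma block_completion_exists (k r s m p : nat) (rho : 'I_k -> nat)
    (L : 'I_r -> 'I_s -> 'I_k) (FR : 'I_r -> 'I_k -> bool) (FC : 'I_s -> 'I_k -> bool)
    (z : 'I_k -> nat) :
  rows_inj L -> cols_inj L ->
  (forall i l, FR i l -> ~~ row_has L i l) -> (forall i, \sum_l FR i l = p) ->
  (forall j l, FC j l -> ~~ row_has (transp L) j l) -> (forall j, \sum_l FC j l = m) ->
  (forall l, \sum_i FR i l + z l <= p) -> (forall l, \sum_j FC j l + z l <= m) ->
  \sum_l z l = m * p ->
  (forall l, ecount L l + \sum_i FR i l + \sum_j FC j l + z l = rho l) ->
  exists T : 'I_r + 'I_m -> 'I_s + 'I_p -> 'I_k, block_completion rho L T.
Proof.
move=> Li Lc FRL FRp FCL FCm xz yz zsum rhoE.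
(* Giving every new row the fraction [z l / m] of each [l] is a fractional
   solution. *)
have [FZ [FZp FZz]] : exists FZ : 'I_m -> 'I_k -> bool,
    (forall i, \sum_l FZ i l = p) /\ (forall l, \sum_i FZ i l = z l).
  (* Division by [m] needs a new row; without one, [yz] forces [z] to vanish. *)
  have [m0|m0] := posnP m.
    exists (fun _ _ => false); split=> [i|l]; first by have := ltn_ord i; rewrite [X in _ < X]m0.
    rewrite big1 //; have := yz l; rewrite m0; lia.
  have [//|i l|i|l|f [f1 fp fz]] :=
      @transport_frac 'I_m 'I_k m (fun _ _ => 1) (fun _ l => z l) (fun=> p) z.
  - by have := yz l; lia.
  - exact: zsum.
  - by rewrite sum_cst card_ord.
  - have fE i l : (f i l == 1) = f i l :> nat by have := f1 i l; case: (f i l) => [|[]].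
    exists (fun i l => f i l == 1); split=> [i|l].
    + by rewrite -(fp i); apply: eq_bigr => l _; rewrite fE.
    + by rewrite -(fz l); apply: eq_bigr => i _; rewrite fE.
pose E (u : 'I_r + 'I_m) l := match u with inl i => FR i l | inr i => FZ i l end.
have [[i|i]|l|g [gE gA gB]] := @edge_coloring _ _ p E; rewrite ?sum_sumType //=.
  by rewrite FZz.
(* A new column keeps only the set of symbols that the first colouring put in its new rows. The
   second colouring places them again, together with those of the old columns. *)
pose E2 (v : 'I_s + 'I_p) l :=
  match v with inl j => FC j l | inr c => [exists i, g (inr i) c == l] end.
have E2p c : \sum_l E2 (inr c) l = m.
  have -> : m = \sum_(i < m) 1 by rewrite sum_cst card_ord muln1.
  transitivity (\sum_l \sum_i (g (inr i) c == l)).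
    apply: eq_bigr => l _; rewrite sum_inj_le1 // => i i' /gB; by case.
  by rewrite exchange_big; apply: eq_bigr => i _; rewrite sum_eq1.
have E2z l : \sum_c E2 (inr c) l <= z l.
  rewrite -FZz; apply: (@leq_trans (\sum_c \sum_i (g (inr i) c == l))).
    apply: leq_sum => c _ /=; case: existsP => // -[i /eqP <-].
    by rewrite (bigD1 i) //= eqxx.
  rewrite exchange_big; apply: leq_sum => i _.
  exact: sum_inj_le (gA _) (fun c => gE (inr i) c).
have [[j|c]|l|h [hE hA hB]] := @edge_coloring _ _ m E2; rewrite ?sum_sumType //=.
  exact: (E2p c).
  by apply: leq_trans (yz l); rewrite leq_add2l; exact: E2z.
pose T (u : 'I_r + 'I_m) (v : 'I_s + 'I_p) : 'I_k :=
  match u, v with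
  | inl i, inl j => L i j
  | inl i, inr c => g (inl i) c
  | inr i, _ => h v i
  end.
have notin_row i j c : L i j <> g (inl i) c.
  by move=> e; have /negP := FRL i _ (gE (inl i) c); apply; apply/existsP; exists j; rewrite e.
have notin_col i j c : L i j <> h (inl j) c.
  move=> e; have /negP := FCL j _ (hE (inl j) c); apply; apply/existsP.
  by exists i; rewrite /transp e.
(* A corner symbol of column [c] was given to [c] by the first colouring in some new row, and that
   colouring does not repeat it in an old row. *)
have notin_corner i c i' : g (inl i) c <> h (inr c) i'.
  move=> e; have /existsP [i2 /eqP e2] := hE (inr c) i'.
  by have := gB c (inr i2) (inl i); rewrite e2 e => /(_ erefl).
exists T; split=> //.
- case=> [i|i] v v'; last exact: hB.
  case: v => [j|c]; case: v' => [j'|c'] /=.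
  + by move/Li => ->.
  + by move/notin_row.
  + by move/esym/notin_row.
  + by move/gA => ->.
- case=> [j|c] [i|i] [i'|i'] /=.
  + by move/Lc => ->.
  + by move/notin_col.
  + by move/esym/notin_col.
  + by move/hA => ->.
  + by move/gB.
  + by move/notin_corner.
  + by move/esym/notin_corner.
  + by move/hA => ->.
have szT : \sum_l rho l = (r + m) * (s + p).
  have eR : \sum_l \sum_i FR i l = r * p.
    by rewrite exchange_big /= (eq_bigr _ (fun i _ => FRp i)) sum_cst card_ord.
  have eC : \sum_l \sum_j FC j l = s * m.
    by rewrite exchange_big /= (eq_bigr _ (fun i _ => FCm i)) sum_cst card_ord.
  rewrite -(eq_bigr _ (fun l _ => rhoE l)) !big_split /= sum_ecount eR eC zsum; lia.
(* Both totals equal the number of cells, so it suffices to bound the count of each symbol from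
   above. *)
apply: sum_leq_eq => [l|].
- rewrite -rhoE sum_sumType /=.
  under eq_bigr => i _ do rewrite sum_sumType /=.
  rewrite big_split /= -ecountE -[leqRHS]addnA leq_add //.
    rewrite leq_add2l; apply: leq_sum => i _.
    exact: sum_inj_le (gA _) (fun c => gE (inl i) c).
  rewrite exchange_big /=.
  apply: (@leq_trans (\sum_v E2 v l)).
    by apply: leq_sum => v _; exact: sum_inj_le (hA _) (hE v).
  by rewrite sum_sumType leq_add2l; exact: E2z.
- rewrite szT exchange_big /= -[X in (X + _) * _](card_ord r) -[X in (_ + X) * _](card_ord m).
  rewrite -card_sum -sum_cst; apply: eq_bigr => u _.
  rewrite exchange_big /= -[X in X + _](card_ord s) -[X in _ + X](card_ord p).
  rewrite -card_sum -[RHS]muln1 -sum_cst; apply: eq_bigr => v _.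
  by rewrite sum_eq1.
Qed.

(** * Block counts in a given completion *)

Lemma block_completion_transp (k r s m p : nat) (rho : 'I_k -> nat)
    (L : 'I_r -> 'I_s -> 'I_k) (T : 'I_r + 'I_m -> 'I_s + 'I_p -> 'I_k) :
  block_completion rho L T -> block_completion rho (transp L) (fun v u => T u v).
Proof. by case=> Tr Tc TL Trho; split=> // l; rewrite exchange_big. Qed.

Section Necessity.
Variables (k r s m p : nat) (rho : 'I_k -> nat) (L : 'I_r -> 'I_s -> 'I_k).
Variable (T : 'I_r + 'I_m -> 'I_s + 'I_p -> 'I_k).
Hypothesis hT : block_completion rho L T.

Definition corner_count l := \sum_i \sum_c (T (inr i) (inr c) == l).
Definition right_count l := \sum_i \sum_c (T (inl i) (inr c) == l).

Lemma right_corner_le l : right_count l + corner_count l <= p.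
Proof.
have [_ Tc _ _] := hT.
rewrite -(sum_sumType (fun u => \sum_c (T u (inr c) == l))) exchange_big /=.
rewrite -[leqRHS]muln1 -[X in _ <= X * _]card_ord -sum_cst.
by apply: leq_sum => c _; rewrite (sum_inj_le (P := predT)) //; exact: (Tc (inr c)).
Qed.

Lemma sum_right_count : \sum_l right_count l = r * p.
Proof.
rewrite exchange_big /= -[X in X * _]card_ord -sum_cst; apply: eq_bigr => i _.
rewrite exchange_big /= -[RHS]muln1 -[X in X * _]card_ord -sum_cst.
by apply: eq_bigr => c _; rewrite sum_eq1.
Qed.

(** Count the new cells of the rows in [I]. Symbols of [K] fill at most their [right_count]; any
    other symbol occurs at most once per row, and only in rows of [I] that lack it. *)
Lemma right_count_bound (I : {set 'I_r}) (K : {set 'I_k}) :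
  #|I| * p <= \sum_(l in K) right_count l + mu_row_set L I (~: K).
Proof.
have [Tr _ TL _] := hT.
have cp (i : 'I_r) : p = \sum_l \sum_c (T (inl i) (inr c) == l).
  rewrite exchange_big /= -[LHS]muln1 -[X in X * _ = _]card_ord -sum_cst.
  by apply: eq_bigr => c _; rewrite sum_eq1.
rewrite -sum_nat_const (eq_bigr _ (fun i _ => cp i)) exchange_big /= (bigID (mem K)) /=.
apply: leq_add.
  apply: leq_sum => l _; rewrite [leqRHS](bigID (mem I)) /=; exact: leq_addr.
rewrite /mu_row_set; under [leqRHS]eq_bigl => l do rewrite inE.
apply: leq_sum => l _; rewrite mu_rowE; apply: leq_sum => i _.
rewrite sum_inj_le1; last by move=> c c' /Tr [].
case: existsP => // -[c /eqP e]; rewrite lt0b; apply/negP => /existsP [j /eqP e'].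
by have : inl j = inr c by apply: (Tr (inl i)); rewrite TL e e'.
Qed.

End Necessity.

Lemma block_completion_count (k r s m p : nat) (rho : 'I_k -> nat)
    (L : 'I_r -> 'I_s -> 'I_k) (T : 'I_r + 'I_m -> 'I_s + 'I_p -> 'I_k) l :
  block_completion rho L T ->
  rho l = ecount L l + right_count T l + right_count (fun v u => T u v) l + corner_count T l.
Proof.
case=> _ _ TL <-; rewrite sum_sumType.
under eq_bigr => i _ do rewrite sum_sumType.
under [X in _ + X]eq_bigr => i _ do rewrite sum_sumType.
rewrite !big_split /= ecountE /right_count /corner_count -!addnA.
congr (_ + (_ + (_ + _))); last by rewrite exchange_big.
by apply: eq_bigr => i _; apply: eq_bigr => j _; rewrite TL.
Qed.

(** * Fitting sequences read as block counts *)

Section Fitting.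
Local Open Scope ring_scope.

Lemma sum_outerP (n k r s : nat) (rho : 'I_k -> nat) (L : 'I_r -> 'I_s -> 'I_k) (a : 'I_k -> nat) :
  (forall l, (ecount L l <= rho l)%N) -> (r <= n)%N ->
  (\sum_l a l)%N%:Z = r%:Z * (n%:Z - s%:Z) + (#|Pset n rho L r|)%:Z * (n%:Z - r%:Z)
    - \sum_(l in Pset n rho L r) def rho L l
  <-> \sum_l (outer n rho L a l)%:Z = r%:Z * (n%:Z - s%:Z).
Proof.
move=> hrho hr; have := sum_outer a hrho hr setT.
have eT (F : 'I_k -> int) : \sum_(l in [set: 'I_k]) F l = \sum_l F l.
  by apply: eq_bigl => l; rewrite inE.
by rewrite setTI Posz_sum !eT => ->; lia.
Qed.

(** The three cases of the bound record which of the two truncated differences inside [outer] are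
    positive: both, one, or none. *)
Lemma fitting_boundP (n k r s : nat) (rho : 'I_k -> nat) (L : 'I_r -> 'I_s -> 'I_k)
    (a b : 'I_k -> nat) l :
  (forall l, (ecount L l <= rho l)%N) -> (r <= n)%N -> (s <= n)%N ->
  ((a l)%:Z + (b l)%:Z <= fitting_bound n rho L l)
  = (ecount L l + outer n rho L a l + outer n rho (transp L) b l <= rho l)%N.
Proof.
move=> hrho hr hs; rewrite /fitting_bound !inE /def /outer ecount_transp.
have := hrho l.
by case: (leqP r s) => ? ?; do ?case: ifP => ?; apply/idP/idP; lia.
Qed.

(** A flow with capacity one on each pair of a row and a symbol absent from it; the last hypothesis
    is nonnegativity of its cuts. *)
Lemma outer_fill (n k r s : nat) (L : 'I_r -> 'I_s -> 'I_k) (x : 'I_k -> nat) :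
  (s <= n)%N -> \sum_l (x l)%:Z = r%:Z * (n%:Z - s%:Z) ->
  (forall (I : {set 'I_r}) (K : {set 'I_k}),
    (#|I|)%:Z * (n%:Z - s%:Z) <= \sum_(l in K) (x l)%:Z + (mu_row_set L I (~: K))%:Z) ->
  exists F : 'I_r -> 'I_k -> bool, [/\ forall i l, F i l -> ~~ row_has L i l,
    forall i, (\sum_l F i l)%N = (n - s)%N & forall l, (\sum_i F i l)%N = x l].
Proof.
move=> hs tx hx.
have restrict (A : finType) (I : {set A}) (F : A -> int) :
    \sum_i F i * (i \in I)%:Z = \sum_(i in I) F i.
  rewrite [RHS]big_mkcond; apply: eq_bigr => i _.
  by case: (i \in I); rewrite ?mulr1 ?mulr0.
have [||f [f1 fp fx]] := @transport_cut 'I_r 'I_k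
    (fun i l => ~~ row_has L i l) (fun=> (n - s)%N%:Z) (fun l => (x l)%:Z).
- by rewrite tx subzn // -Posz_sum sum_cst card_ord PoszM.
- move=> I K; have := hx I K; rewrite /cut subr_ge0 !restrict sum_card -subzn //.
  suff -> : \sum_u (~~ row_has L u.1 u.2)%:Z * ((u.1 \in I) && (u.2 \notin K))%:Z
      = (mu_row_set L I (~: K))%:Z by rewrite [X in _ -> _ <= X]addrC.
  transitivity (\sum_i \sum_l (~~ row_has L i l)%:Z * ((i \in I) && (l \notin K))%:Z).
    by rewrite pair_bigA.
  rewrite exchange_big mu_row_setZ [RHS]big_mkcond; apply: eq_bigr => l _; rewrite inE.
  case: (l \in K) => /=; first by rewrite big1 // => i _; rewrite andbF mulr0.
  rewrite mu_rowE [X in _ = X%:Z]big_mkcond Posz_sum; apply: eq_bigr => i _.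
  by case: (i \in I); rewrite /= ?mulr1 ?mulr0.
- have fE i l : (f i l == 1%N) = f i l :> nat.
    by have := f1 i l; case: (row_has _ _ _); case: (f i l) => [|[]].
  exists (fun i l => f i l == 1%N); split=> [i l /eqP e|i|l].
  + by have := f1 i l; rewrite e; case: row_has.
  + apply/eqP; rewrite -eqz_nat Posz_sum -(fp i); apply/eqP.
    by apply: eq_bigr => l _; rewrite fE.
  + apply/eqP; rewrite -eqz_nat Posz_sum -(fx l); apply/eqP.
    by apply: eq_bigr => i _; rewrite fE.
Qed.

End Fitting.

(** * Passage between completions and fitting sequences *)

Theorem theorem1p2 (n k r s : nat) (rho : 'I_k -> nat) (L : 'I_r -> 'I_s -> 'I_k) :
  (forall l : 'I_k, 1 <= rho l <= n) -> n <= k -> \sum_(l : 'I_k) rho l = n ^ 2 ->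
  is_rho_rect rho L -> r <= n -> s <= n -> minn r s < n ->
  (forall a b : 'I_k -> nat, fitting n rho L a b ->
     [<-> R1 n rho L a; R2 n rho L a; R3 n rho L a; R4 n rho L a; R5 n rho L a; R6 n rho L a]
  /\ [<-> C1 n rho L b; C2 n rho L b; C3 n rho L b; C4 n rho L b; C5 n rho L b; C6 n rho L b])
  /\
  (completable n rho L <->
     exists a b : 'I_k -> nat, [/\ fitting n rho L a b, R1 n rho L a & C1 n rho L b]).
Proof.
move=> _ _ rho_sum [Li Lc hrho] hr hs _.
have hrhoT l : ecount (transp L) l <= rho l by rewrite ecount_transp.
have LiT : rows_inj (transp L) by move=> j i i'; apply: Lc.
have defT : def rho (transp L) =1 def rho L by move=> l; rewrite /def ecount_transp.
have fitE a b : fitting n rho L a b <->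
    [/\ (\sum_l (outer n rho L a l)%:Z = r%:Z * (n%:Z - s%:Z))%R,
        (\sum_l (outer n rho (transp L) b l)%:Z = s%:Z * (n%:Z - r%:Z))%R
      & forall l, ecount L l + outer n rho L a l + outer n rho (transp L) b l <= rho l].
  have [a1 a2] := sum_outerP (s := s) a hrho hr.
  have [b1 b2] := sum_outerP (s := r) b hrhoT hs.
  rewrite Pset_transp (eq_bigr _ (fun l _ => defT l)) in b1 b2.
  split=> [[f1 f2 f3]|[f1 f2 f3]].
    by split; [exact: a1 | exact: b1 | move=> l; rewrite -fitting_boundP].
  by split; [exact: a2 | exact: b2 | move=> l; rewrite fitting_boundP].
split=> [a b /fitE [ta tb _]|].
  (* The column conditions are the row conditions of the transposed rectangle. *)
  by split; [exact: R_equiv | exact: (R_equiv hrhoT hs LiT tb)].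
split=> [/(completableP _ _ hr hs) [T hT]|[a [b [/fitE [ta tb tab] ha hb]]]].
- have hT' := block_completion_transp hT.
  (* The subtraction never truncates: the copies of [l] outside [L] and the right block lie in the
     [n - r] new rows, at most one in each. The same holds for [b] with the new columns. *)
  pose a l := right_count T l - ((rho l - ecount L l) - (n - r)).
  pose b l := right_count (fun v u => T u v) l - ((rho l - ecount L l) - (n - s)).
  have rhoE l := block_completion_count l hT.
  have cornerT l : corner_count (fun v u => T u v) l = corner_count T l.
    exact: exchange_big.
  have aE l : outer n rho L a l = right_count T l.
    by have := right_corner_le hT' l; have := rhoE l; rewrite cornerT /outer /a; lia.
  have bE l : outer n rho (transp L) b l = right_count (fun v u => T u v) l.
    by have := right_corner_le hT l; have := rhoE l; rewrite /outer /b ecount_transp; lia.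
  have ta : (\sum_l (outer n rho L a l)%:Z = r%:Z * (n%:Z - s%:Z))%R.
    by rewrite -Posz_sum (eq_bigr _ (fun l _ => aE l)) sum_right_count PoszM subzn.
  have tb : (\sum_l (outer n rho (transp L) b l)%:Z = s%:Z * (n%:Z - r%:Z))%R.
    by rewrite -Posz_sum (eq_bigr _ (fun l _ => bE l)) sum_right_count PoszM subzn.
  exists a, b; split.
  + by apply/fitE; split=> // l; rewrite aE bE (rhoE l); lia.
  + apply/(R1P a hrho hr) => I K.
    have := right_count_bound hT I K.
    rewrite -(eq_bigr _ (fun l _ => aE l)) -lez_nat PoszD PoszM subzn //.
    by rewrite (big_morph Posz PoszD (erefl _)).
  + apply/(R1P b hrhoT hs) => I K.
    have := right_count_bound hT' I K.
    rewrite -(eq_bigr _ (fun l _ => bE l)) -lez_nat PoszD PoszM subzn //.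
    by rewrite (big_morph Posz PoszD (erefl _)).
- apply/(completableP _ _ hr hs).
  have /(R1P a hrho hr) ha' := ha.
  have /(R1P b hrhoT hs) hb' := hb.
  have [FR [FRL FRp FRx]] := outer_fill hs ta ha'.
  have [FC [FCL FCp FCx]] := outer_fill hr tb hb'.
  pose z l := rho l - ecount L l - outer n rho L a l - outer n rho (transp L) b l.
  apply: (@block_completion_exists _ _ _ _ _ rho L FR FC z) => // [l|l||l].
  (* The [outer] of the transpose is at least [(rho l - ecount L l) - (n - s)], so at most [n - s]
     copies remain for the new columns. *)
  + by rewrite FRx /z; have := tab l; rewrite /outer ecount_transp; lia.
  + by rewrite FCx /z; have := tab l; rewrite /outer ecount_transp; lia.
  (* Removing the other three blocks from the [n ^ 2] cells leaves the [(n - r) * (n - s)] cells of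
     the corner. *)
  + have : \sum_l rho l = \sum_l (ecount L l + outer n rho L a l
                                 + outer n rho (transp L) b l + z l).
      by apply: eq_bigr => l _; have := tab l; rewrite /z; lia.
    rewrite rho_sum 3!big_split sum_ecount => e.
    have {}ta : \sum_l outer n rho L a l = r * (n - s).
      by apply/eqP; rewrite -eqz_nat Posz_sum ta PoszM subzn.
    have {}tb : \sum_l outer n rho (transp L) b l = s * (n - r).
      by apply/eqP; rewrite -eqz_nat Posz_sum tb PoszM subzn.
    have nn : n ^ 2 = (r + (n - r)) * (s + (n - s)) by rewrite !subnKC // mulnn.
    by move: e; rewrite ta tb nn mulnDl !mulnDr /=; lia.
  + by rewrite FRx FCx /z; have := tab l; lia.
Qed.
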